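(* Let $\mathcal X$ be a proper metric space satisfying the shrinking assumption (A) given in the context. Let $\mu\in\mathcal P(\mathcal X\times\{0,1\})$ be a probability measure and let $\varrho_i:=\mu(\,\cdot\,\times\{i\})$ for $i\in\{0,1\}$. For every $u\in C(\mathcal X)$ it holds $$\mathrm{TV}_\varepsilon(u)=\max_{(\mathbf m^0,\mathbf m^1)\in\mathfrak M\times\mathfrak M}\left\{\int_{\mathcal X}\int_{\mathcal X}\mathrm{grad}_\varepsilon[u](x,y)\,\mathrm dm^0_x(y)\,\mathrm d\varrho_0(x)+\int_{\mathcal X}\int_{\mathcal X}-\mathrm{grad}_\varepsilon[u](x,y)\,\mathrm dm^1_x(y)\,\mathrm d\varrho_1(x)\right\}$$ $$=\max_{\underline{\mathbf m}=(\mathbf m^0,\mathbf m^1)\in\mathfrak M\times\mathfrak M}\int_{\mathcal X}\int_{\mathcal X}\mathrm{grad}_\varepsilon[u](x,y)\,[\underline{\mathbf m};\boldsymbol\varrho](x,y)\,\mathrm dn_x(y)\,\mathrm d\varrho(x).$$ For every bounded continuous $u\in C_b(\mathcal X)$ it moreover holds $$\mathrm{TV}_\varepsilon(u)=\max_{\underline{\mathbf m}\in\mathfrak M\times\mathfrak M}\;-\int_{\mathcal X}u(x)\,\mathrm d\,\mathrm{div}^{\boldsymbol\varrho}_\varepsilon[\underline{\mathbf m}](x).$$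
   Context: Fix $\varepsilon>0$. A metric space $(\mathcal X,\mathrm d)$ is proper if every closed and bounded subset is compact. $\overline{\mathrm B}_r(x)=\{y\in\mathcal X:\mathrm d(x,y)\le r\}$; $\mathcal P(\cdot)$ denotes Borel probability measures, $\mathcal M_f^\pm(\mathcal X)$ finite signed Radon measures, $\mathfrak B_{\mathcal X}$ the Borel $\sigma$-algebra. Assumption (A): for every $x\in\mathcal X$ and $0<r<\varepsilon$ there is a measurable map $T_{x,r}:\overline{\mathrm B}_\varepsilon(x)\to\overline{\mathrm B}_{\varepsilon-r}(x)$ with $\mathrm d(T_{x,r}(y),y)\le r$ for all $y\in\overline{\mathrm B}_\varepsilon(x)$. Put $\varrho:=\varrho_0+\varrho_1$ and $\boldsymbol\varrho=(\varrho_0,\varrho_1)$. For $u\in C(\mathcal X)$ the adversarial total variation is $$\mathrm{TV}_\varepsilon(u)=\int_{\mathcal X}\frac{\max_{\overline{\mathrm B}_\varepsilon(x)}u-u(x)}{\varepsilon}\,\mathrm d\varrho_0(x)+\int_{\mathcal X}\frac{u(x)-\min_{\overline{\mathrm B}_\varepsilon(x)}u}{\varepsilon}\,\mathrm d\varrho_1(x).$$ A random walk $\mathbf m\in RW(\mathcal X)$ is a family $\mathbf m=(m_x)_{x\in\mathcal X}$ of Borel probability measures on $\mathcal X$ such that (i) for all Borel $A\subset\mathcal X$ and Borel $B\subset\mathbb R$ the set $\{x:m_x(A)\in B\}$ is Borel; (ii) for some $x_0\in\mathcal X$ and all $x\in\mathcal X$, $\int_{\mathcal X}\mathrm d(x_0,y)\,\mathrm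 dm_x(y)<\infty$. Set $$\mathfrak M:=\{\mathbf m\in RW(\mathcal X):\ \mathrm{supp}\,m_x\subset\overline{\mathrm B}_\varepsilon(x)\text{ for }\varrho\text{-a.e. }x\in\mathcal X\}.$$ Nonlocal gradient: $\mathrm{grad}_\varepsilon[u](x,y)=\frac{u(y)-u(x)}{\varepsilon}$. Nonlocal weighted divergence: for $\mathbf m\in RW(\mathcal X)$, $A\in\mathfrak B_{\mathcal X}$, $$\mathrm{div}_\varepsilon^{\varrho_i}[\mathbf m](A)=\frac1\varepsilon\Big(\int_A m_x(\mathcal X)\,\mathrm d\varrho_i(x)-\int_{\mathcal X}m_x(A)\,\mathrm d\varrho_i(x)\Big),$$ and for $\underline{\mathbf m}=(\mathbf m^0,\mathbf m^1)\in RW(\mathcal X)\times RW(\mathcal X)$, $\mathrm{div}_\varepsilon^{\boldsymbol\varrho}[\underline{\mathbf m}]:=\mathrm{div}_\varepsilon^{\varrho_0}[\mathbf m^0]-\mathrm{div}_\varepsilon^{\varrho_1}[\mathbf m^1]\in\mathcal M_f^\pm(\mathcal X)$. Given $\underline{\mathbf m}$, set $n_x:=\frac{m^0_x+m^1_x}{2}$ and, using Radon–Nikodym derivatives, $$[\underline{\mathbf m};\boldsymbol\varrho](x,y):=\frac{\mathrm d\varrho_0}{\mathrm d\varrho}(x)\frac{\mathrm dm^0_x}{\mathrm dn_x}(y)-\frac{\mathrm d\varrho_1}{\mathrm d\varrho}(x)\frac{\mathrm dm^1_x}{\mathrm dn_x}(y),$$ regarded as a measurable function on $\mathcal X\times\mathcal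 X$. *)

(* Defs.v *)
From HB Require Import structures.
From mathcomp Require Import all_boot all_order all_algebra.
From mathcomp Require Import all_classical all_reals all_analysis.

Set Implicit Arguments.
Unset Strict Implicit.
Unset Printing Implicit Defensive.

Import Order.TTheory GRing.Theory Num.Theory.
Import numFieldNormedType.Exports.

Local Open Scope classical_set_scope.
Local Open Scope ring_scope.
Local Open Scope ereal_scope.
Local Open Scope charge_scope.

(* A metric space carrying its Borel sigma-algebra. Measurable types are pointed
   in the library; this costs nothing below, where a probability measure on
   X * bool is given. *)
HB.mixin Record Measurable_isBorel (d : measure_display) (R : numDomainType) X
    & Metric R X & Measurable d X := {
  borel_measurableE : @measurable d X = <<s @open X >>
}.

#[short(type="borelMetricType")]
HB.structure Definition BorelMetric (d : measure_display) (R : numDomainType) :=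
  { X of Metric R X & Measurable d X & Measurable_isBorel d R X }.

Section metric.
Context {d : measure_display} {R : realType} {X : borelMetricType d R}.

(* Not the library's [closed_ball], which is the closure of the open ball. *)
Definition cball (x : X) (r : R) : set X := [set y | (mdist x y <= r)%R].

Definition proper_space : Prop := forall A : set X,
  closed A -> (exists x r, A `<=` cball x r) -> compact A.

(* T is a total function on X, of which only the restriction to the closed ball
   of radius eps is used; [measurable_fun D] is measurability of that
   restriction for the trace sigma-algebra on D. *)
Definition shrinking (eps : R) : Prop := forall (x : X) (r : R),
  (0 < r < eps)%R -> exists T : X -> X,
  [/\ measurable_fun (cball x eps) T,
      forall y, cball x eps y -> cball x (eps - r) (T y)
    & forall y, cball x eps y -> (mdist (T y) y <= r)%R].

Definition supp (p : set X -> \bar R) : set X :=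
  [set y | forall U : set X, open U -> U y -> 0 < p U].

End metric.
Arguments proper_space {d R} X.
Arguments shrinking {d R} X eps.

(* The labels 0 and 1 are the booleans false and true. *)
Section marginal.
Context {d : measure_display} {R : realType} {X : measurableType d}.
Variables (mu : probability (X * bool)%type R) (i : bool).

Definition marginal (A : set X) : \bar R := mu (A `*` [set i]).

Let mX1 (A : set X) : measurable A -> measurable (A `*` [set i]).
Proof. by move=> mA; exact: measurableX. Qed.

Let marginal0 : marginal set0 = 0.
Proof. by rewrite /marginal set0X measure0. Qed.

Let marginal_ge0 A : 0 <= marginal A.
Proof. exact: measure_ge0. Qed.

Let marginal_sigma_additive : semi_sigma_additive marginal.
Proof.
move=> F mF tF mUF; rewrite /marginal setX_bigcupl.
apply: measure_semi_sigma_additive => [n| |].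
- exact: mX1.
- apply/trivIsetP => j k _ _ jk.
  by rewrite -setXI setIid; move/trivIsetP : tF => ->//; rewrite set0X.
- by rewrite -setX_bigcupl; exact: mX1.
Qed.

HB.instance Definition _ := isMeasure.Build _ _ _ marginal
  marginal0 marginal_ge0 marginal_sigma_additive.

Let marginal_fin_num : fin_num_fun marginal.
Proof. by move=> A mA; apply: fin_num_measure; exact: mX1. Qed.

HB.instance Definition _ :=
  Measure_isFinite.Build _ _ _ marginal marginal_fin_num.

End marginal.

Section measure_add_finite.
Context {d : measure_display} {R : realType} {X : measurableType d}.
Variables p q : {finite_measure set X -> \bar R}.

Definition fmeasure_add : set X -> \bar R := measure_add p q.

HB.instance Definition _ := Measure.on fmeasure_add.

Let fmeasure_add_fin_num : fin_num_fun fmeasure_add.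
Proof.
by move=> A mA; rewrite /fmeasure_add measure_addE fin_numD !fin_num_measure.
Qed.

HB.instance Definition _ :=
  Measure_isFinite.Build _ _ _ fmeasure_add fmeasure_add_fin_num.

End measure_add_finite.

(* The measure m_x, as a finite measure. *)
Section kmeas.
Context {d : measure_display} {R : realType} {X : measurableType d}.
Variables (m : R.-pker X ~> X) (x : X).

Definition kmeas : set X -> \bar R := m x.

HB.instance Definition _ := Measure.on kmeas.

HB.instance Definition _ :=
  Measure_isFinite.Build _ _ _ kmeas (@finite_kernel_measure _ _ _ _ _ m x).

End kmeas.

(* Integral against a signed measure, through its Jordan decomposition (which
   does not depend on the Hahn decomposition chosen). *)
Definition charge_integral {d : measure_display} {R : realType}
    {X : measurableType d} (nu : {charge set X -> \bar R}) (f : X -> \bar R) :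
    \bar R :=
  let nuPN := projT2 (cid (projT2 (cid (Hahn_decomposition nu)))) in
  \int[jordan_pos nuPN]_x f x - \int[jordan_neg nuPN]_x f x.

Section divergence.
Context {d : measure_display} {R : realType} {X : measurableType d}.
Variables (eps : R) (rho : {finite_measure set X -> \bar R})
  (m : R.-pker X ~> X).

Definition div_eps (A : set X) : \bar R :=
  (eps^-1)%:E * ((\int[rho]_(x in A) m x setT) - (\int[rho]_x m x A)).

Let mu1 (A : set X) : \bar R := \int[rho]_(x in A) m x setT.
Let mu2 (A : set X) : \bar R := \int[rho]_x m x A.

Let div0 : div_eps set0 = 0.
Proof.
by rewrite /div_eps integral_set0 integral0_eq ?sube0 ?mule0.
Qed.

Let mu1E A : measurable A -> mu1 A = rho A.
Proof.
move=> mA; rewrite /mu1 (eq_integral (cst 1)) => [|x _]; last exact: prob_kernel.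
by rewrite integral_cst// mul1e.
Qed.

Let mu2_fin_num A : measurable A -> mu2 A \is a fin_num.
Proof.
move=> mA; rewrite ge0_fin_numE ?integral_ge0//.
apply: (@le_lt_trans _ _ (\int[rho]_x cst 1 x)).
  apply: ge0_le_integral => //; first exact: measurable_kernel.
  by move=> x _; rewrite -(@prob_kernel _ _ _ _ _ m x) le_measure ?inE.
by rewrite integral_cst// mul1e ltey_eq fin_num_measure.
Qed.

Let div_fin_num A : measurable A -> div_eps A \is a fin_num.
Proof.
move=> mA; rewrite fin_numM// fin_numB -/(mu1 A) -/(mu2 A) mu1E//.
by rewrite fin_num_measure// mu2_fin_num.
Qed.

Let mu2_sigma_additive : semi_sigma_additive mu2.
Proof.
move=> F mF tF mUF.
rewrite [X in X @ _ --> _](_ : _ =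
    (fun n => \sum_(0 <= i < n) \int[rho]_x m x (F i)))//.
rewrite {1}/mu2 (eq_integral (fun x => \sum_(i <oo) m x (F i))); last first.
  by move=> x _; rewrite measure_semi_bigcup.
rewrite integral_nneseries//; last by move=> n; exact: measurable_kernel.
by apply: is_cvg_ereal_nneg_natsum => n _; exact: integral_ge0.
Qed.

Let div_sigma_additive : semi_sigma_additive div_eps.
Proof.
move=> F mF tF mUF; rewrite /div_eps -/(mu1 _) -/(mu2 _) mu1E//.
rewrite [X in X @ _ --> _](_ : _ = (fun n => (eps^-1)%:E *
    (\sum_(0 <= i < n) rho (F i) - \sum_(0 <= i < n) mu2 (F i)))); last first.
  apply/funext => n; rewrite -fin_num_sumeN; last first.
    by move=> i _; exact: mu2_fin_num.
  rewrite -big_split/= fin_num_sume_distrr//; last first.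
    move=> i j _ _; rewrite fin_num_adde_defl// fin_numB.
    by rewrite fin_num_measure// mu2_fin_num.
  by apply: eq_bigr => i _; rewrite -/(mu1 _) -/(mu2 _) mu1E.
apply: cvgeZl => //; apply: cvgeB.
- by rewrite fin_num_adde_defr// fin_num_measure.
- exact: measure_semi_sigma_additive.
- exact: mu2_sigma_additive.
Qed.

HB.instance Definition _ :=
  isCharge.Build _ _ _ div_eps div0 div_fin_num div_sigma_additive.

End divergence.

Section adversarial.
Context {d : measure_display} {R : realType} {X : borelMetricType d R}.
Variables (eps : R) (rho0 rho1 : {finite_measure set X -> \bar R}).
Implicit Types (u : X -> R) (m : R.-pker X ~> X).

(* For continuous u on a proper space the closed balls are compact, so that the
   sup and inf are the maximum and minimum of u on the ball. *)
Definition TV u : \bar R :=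
  (\int[rho0]_x ((sup (u @` cball x eps) - u x) / eps)%:E) +
  (\int[rho1]_x ((u x - inf (u @` cball x eps)) / eps)%:E).

(* The measurability clause in the definition of a random walk is part of the
   structure of a probability kernel. *)
Definition random_walk m : Prop :=
  exists x0 : X, forall x, \int[m x]_y (mdist x0 y)%:E < +oo.

Definition admissible : set (R.-pker X ~> X) :=
  [set m | random_walk m /\
    {ae fmeasure_add rho0 rho1, forall x, supp (m x) `<=` cball x eps}].

Definition grad_eps u (x y : X) : R := (u y - u x) / eps.

Definition div_pair m0 m1 : {charge set X -> \bar R} :=
  cadd (div_eps eps rho0 m0) (copp (div_eps eps rho1 m1)).

Definition midpoint m0 m1 (x : X) : {finite_measure set X -> \bar R} :=
  mscale (2^-1)%:nng%R (fmeasure_add (kmeas m0 x) (kmeas m1 x)).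

(* [m; rho] (x, y), for the library's version of each derivative. Any other choice
   of versions, in particular a jointly measurable one, gives for rho-almost every
   x the same integrals in y against n_x, hence the same iterated integrals. *)
Definition bracket m0 m1 (x y : X) : \bar R :=
  ('d (charge_of_finite_measure rho0) '/d (fmeasure_add rho0 rho1)) x *
    ('d (charge_of_finite_measure (kmeas m0 x)) '/d (midpoint m0 m1 x)) y -
  ('d (charge_of_finite_measure rho1) '/d (fmeasure_add rho0 rho1)) x *
    ('d (charge_of_finite_measure (kmeas m1 x)) '/d (midpoint m0 m1 x)) y.

(* For unbounded u the integrals below may be of the form oo - oo; the library
   convention gives them the value -oo, so that such m0, m1 are irrelevant in
   a maximum. *)
Definition grad_energy u m0 m1 : \bar R :=
  (\int[rho0]_x \int[m0 x]_y (grad_eps u x y)%:E) +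
  (\int[rho1]_x \int[m1 x]_y (- grad_eps u x y)%:E).

Definition bracket_energy u m0 m1 : \bar R :=
  \int[fmeasure_add rho0 rho1]_x
    \int[midpoint m0 m1 x]_y ((grad_eps u x y)%:E * bracket m0 m1 x y).

Definition div_energy u m0 m1 : \bar R :=
  - charge_integral (div_pair m0 m1) (EFin \o u).

End adversarial.

Definition is_max {R : realType} (A : set (\bar R)) (v : \bar R) : Prop :=
  A v /\ ubound A v.

(* Main.v *)
(* At a point x whose m_x is supported in the closed eps-ball, the mean of
   grad_eps u against m_x is at most (max u - u(x)) / eps, and the Dirac mass at a
   maximizer of u on the ball attains this bound; the second term is the same
   statement for -u. So everything rests on a Borel choice x |-> T(x) of
   maximizers. It is obtained by maximizing lexicographically, over the compact
   ball, first u and then the functions -d(s_n, .) for a dense sequence s: a point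
   being determined by its distances to the s_n, one point survives. At each stage
   the maximizers form a compact set F(x) such that {x | F(x) meets C} is Borel for
   every closed C, because the maximum of f over F(x) is attained in C if and only
   if, for every rational q, F(x) meets {f >= q} only if it meets C and {f >= q}.

   The bracket energy is the same integral written against n_x and rho, by change
   of variables for the Radon-Nikodym derivatives. The divergence is a difference
   of two finite measures, against which bounded u integrate to minus the gradient
   energy. *)
From HB Require Import structures.
Require Import Defs.
From mathcomp Require Import finmap all_boot all_order all_algebra.
From mathcomp Require Import all_classical all_reals all_analysis.
From mathcomp Require Import measurable_realfun lra.
Import Order.TTheory GRing.Theory Num.Theory.
Import numFieldNormedType.Exports.

Set Implicit Arguments.
Unset Strict Implicit.
Unset Printing Implicit Defensive.

Local Open Scope classical_set_scope.
Local Open Scope ring_scope.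

(** * Borel selection of maximizers *)

Section borel_metric.
Context {R : realType} {d : measure_display} {X : borelMetricType d R}.
Implicit Types (A C : set X) (x y : X).

Lemma borel_open A : open A -> measurable A.
Proof. by move=> oA; rewrite borel_measurableE; exact: sub_sigma_algebra. Qed.

Lemma borel_closed C : closed C -> measurable C.
Proof. by move=> cC; rewrite -[C]setCK; apply/measurableC/borel_open/closed_openC. Qed.

Lemma measurable_fun_closed (T : X -> X) :
  (forall C, closed C -> measurable (T @^-1` C)) -> measurable_fun setT T.
Proof.
move=> TC; apply: (measurability open); first exact: borel_measurableE.
move=> _ [A oA <-]; rewrite setTI -[X in measurable X]setCK.
by apply: measurableC; apply: (TC (~` A)); exact: open_closedC.
Qed.

Lemma continuous_borel (u : X -> R) : continuous u -> measurable_fun setT u.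
Proof.
move=> cu; apply: (measurability _ (RGenOpens.measurableE R)).
move=> _ [_ [a [b ->]] <-]; rewrite setTI; apply: borel_open.
by apply: open_comp => //; exact: interval_open.
Qed.

Lemma mdist_continuous x : continuous (fun y : X => mdist x y).
Proof.
move=> y; apply/(@cvgrPdist_lt R R) => e e0.
have : nbhs y (ball y e) by exact: nbhsx_ballx.
apply: filterS => z; rewrite ballEmdist/= => yz.
rewrite ltr_norml; have := metric_triangle x y z.
by have := metric_triangle x z y; rewrite (metric_sym z y); lra.
Qed.

Lemma metric_ball_open x r : open (ball x r : set X).
Proof.
rewrite (ballEmdist x r).
apply: (@open_comp _ _ (mdist x) [set t | t < r]); last exact: open_lt.
by move=> y _; exact: mdist_continuous.
Qed.

Lemma cball_closed x r : closed (cball x r : set X).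
Proof.
apply: (@closed_comp _ _ (mdist x) [set t | t <= r]); last exact: closed_le.
by move=> y _; exact: mdist_continuous.
Qed.

Lemma cball_center x r : 0 <= r -> cball x r x.
Proof. by move=> r0; rewrite /cball/= mdistxx. Qed.

End borel_metric.

(** * Set-valued maps with compact values and their maximizers *)

Section argmax.
Context {R : realType} {d : measure_display} {X : borelMetricType d R}.
Implicit Types (C : set X) (x y : X) (F : X -> set X) (f : X -> R).

(** This is the lower inverse image of [C] under the set-valued map [F]. Testing it on closed rather
    than open [C] makes the class of test sets stable under intersection with superlevel sets of a
    continuous function. *)
Definition hits C F : set X := [set x | (F x `&` C) !=set0].

Definition compact_selectable F := [/\ forall x, F x !=set0,
  forall x, compact (F x) & forall C, closed C -> measurable (hits C F)].

Definition argmax f F x : set X :=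
  [set y | F x y /\ forall z, F x z -> f z <= f y].

Lemma compact_max (K : set X) f : continuous f -> K !=set0 -> compact K ->
  exists2 c, K c & forall y, K y -> f y <= f c.
Proof.
move=> cf K0 cK.
have [|c /set_mem Kc fc] := @compact_EVT_max X R f K K0 cK.
  exact: continuous_subspaceT.
by exists c => // y Ky; apply: fc; exact: mem_set.
Qed.

Lemma argmax_selectable f F : continuous f -> compact_selectable F ->
  compact_selectable (argmax f F).
Proof.
move=> cf [F0 cF mF].
have cge r : closed [set y | r <= f y].
  by apply: (@closed_comp _ _ f [set t | r <= t]) => //; exact: closed_ge.
split => [x|x|C cC].
- by have [c Fc fc] := compact_max cf (F0 x) (cF x); exists c.
- have [c Fc fc] := compact_max cf (F0 x) (cF x).
  rewrite (_ : argmax f F x = F x `&` [set y | f c <= f y]).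
    by apply: compact_closedI => //; exact: cge.
  apply/seteqP; split => y [Fy /= fy]; split => //; first exact: fy.
  by move=> z Fz; rewrite (le_trans (fc _ Fz)).
- rewrite (_ : hits C (argmax f F) = \bigcap_(q : rat)
      (~` hits [set y | ratr q <= f y] F `|`
       hits (C `&` [set y | ratr q <= f y]) F)).
    rewrite -[X in measurable X]setCK setC_bigcap; apply: measurableC.
    apply: bigcupT_measurable_rat => q; apply: measurableC.
    apply: measurableU; first by apply/measurableC/mF/cge.
    by apply: mF; exact: closedI.
  apply/seteqP; split => x.
    move=> [y [[Fy fy] Cy]] q _.
    have [[z [Fz /= qz]]|] := pselect (hits [set y | ratr q <= f y] F x).
      by right; exists y; split => //; split => //=; exact: le_trans qz (fy _ Fz).
    by left.
  move=> hx; have [c Fc fc] := compact_max cf (F0 x) (cF x).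
  (* A rational [q] between [r] and the maximum [f c] has [c] itself in its superlevel set, so the
     first alternative of [hx] is excluded and the second gives a point of [C]. *)
  have hit r : r < f c -> exists y, [/\ F x y, C y & r <= f y].
    move=> rc; have [q] := rat_in_itvoo rc; rewrite in_itv/= => /andP[rq qc].
    have [|[y [Fy [Cy /= qy]]]] := hx q I.
      by case; exists c; split => //=; exact: ltW.
    by exists y; split => //; exact: le_trans (ltW rq) qy.
  have K0 : F x `&` C !=set0.
    by have [|y [Fy Cy _]] := hit (f c - 1); [lra|exists y].
  have [y [Fy Cy] fy] := compact_max cf K0 (compact_closedI (cF x) cC).
  exists y; split => //; split => // z Fz; apply: (le_trans (fc _ Fz)).
  (* If the maximum [f y] over the part of [F x] in [C] were below [f c], then [hit] at the midpoint
     level would give a point of [C] where [f] exceeds [f y]. *)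
  rewrite leNgt; apply/negP => /midf_lt[ym mc].
  have [z' [Fz' Cz' mz']] := hit _ mc.
  by have := lt_le_trans ym (le_trans mz' (fy _ (conj Fz' Cz'))); rewrite ltxx.
Qed.

(** Pick a point in each [K n]. The sequence has a cluster point in [K 0]; its tail from [n] on lies
    in [K n], which is closed, so the cluster point lies in every [K n]. *)
Lemma nested_compact_inter (K : nat -> set X) :
  (forall n, K n !=set0) -> (forall n, compact (K n)) ->
  (forall n, K n.+1 `<=` K n) -> \bigcap_n K n !=set0.
Proof.
move=> K0 cK Kn.
have Kle n m : (n <= m)%N -> K m `<=` K n.
  elim: m => [|m IH]; first by rewrite leqn0 => /eqP->.
  by rewrite leq_eqVlt => /predU1P[->//|/IH]; apply: subset_trans; exact: Kn.
pose y n := projT1 (cid (K0 n)).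
have yK n : K n (y n) by rewrite /y; case: cid.
have [|p [_ py]] := cK 0%N (y @ \oo).
  by exists 0%N => // n _; exact: (Kle 0%N n).
exists p => n _; apply: (compact_closed (@metric_hausdorff R X) (cK n)).
move=> B Bp; apply: py => //.
by exists n => // m /= nm; exact: (Kle n m).
Qed.

End argmax.

(** * Selection and supports in proper spaces *)

Section proper.
Context {R : realType} {d : measure_display} {X : borelMetricType d R}.
Hypothesis X_proper : proper_space X.

Lemma cball_compact (x : X) r : compact (cball x r).
Proof. by apply: X_proper; [exact: cball_closed|exists x, r]. Qed.

(** The set of [x] whose ball meets [C] is even closed. A limit [x] of such points has points of [C]
    at distance less than [eps + r] for every [r > 0], and by compactness a nearest point of [C]
    exists; it cannot be farther than [eps]. *)
Lemma cball_selectable (eps : R) : 0 <= eps ->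
  compact_selectable (fun x : X => cball x eps).
Proof.
move=> eps0; split => [x|x|C cC]; first by exists x; exact: cball_center.
  exact: cball_compact.
apply: borel_closed => x clx.
have near r : 0 < r -> exists c, C c /\ mdist x c < eps + r.
  move=> r0; have [z [[c [/= zc Cc]]]] := clx _ (nbhsx_ballx x _ r0).
  rewrite ballEmdist/= => xz; exists c; split => //.
  by have := metric_triangle x z c; rewrite /cball/= in zc; lra.
have [c [xc Cc] xc_min] : exists2 c, (cball x (eps + 1) `&` C) c &
    forall y, (cball x (eps + 1) `&` C) y -> - mdist x y <= - mdist x c.
  apply: (@compact_max _ _ X _ (fun y => - mdist x y)).
  - by move=> y; apply: continuousN; exact: mdist_continuous.
  - by have [c [Cc xc]] := near _ ltr01; exists c; split => //; exact: ltW.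
  - by apply: compact_closedI => //; exact: cball_compact.
exists c; split => //=; rewrite /cball/= leNgt; apply/negP => epsc.
(* The bound 1 keeps [c'] in the ball of radius [eps + 1] where [c] is nearest; the other bound
   makes [c'] strictly nearer than [c]. *)
have [|c' [Cc' xc']] := near (Num.min 1 (mdist x c - eps)).
  by rewrite lt_min ltr01 subr_gt0.
have : - mdist x c' <= - mdist x c.
  apply: xc_min; split => //.
  by rewrite /cball/= (le_trans (ltW xc'))// lerD2l ge_min lexx.
rewrite lerN2 leNgt => /negP; apply; apply: (lt_le_trans xc').
by rewrite -lerBrDl ge_min lexx orbT.
Qed.

(** For all [n] and [k] the compact ball of radius [n] about a base point is covered by finitely
    many balls of radius [1/(k+1)]. The centers, indexed by triples [(n, k, i)], are enumerated
    through a coding of triples by naturals; numbers that code nothing are sent to the base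
    point. *)
Lemma dense_sequence :
  exists s : nat -> X, forall x e, 0 < e -> exists n, mdist (s n) x < e.
Proof.
pose x0 : X := point.
have npos (k : nat) : 0 < k.+1%:R^-1 :> R by rewrite invr_gt0.
have cov n k : exists D : {fset X},
    cball x0 n%:R `<=` cover [set` D] (fun z => (ball z (k.+1%:R^-1 : R))^°).
  have := @cball_compact x0 n%:R; rewrite compact_cover => /(_ _ setT
    (fun z : X => (ball z (k.+1%:R^-1 : R))^°)).
  case=> [z _|z _|D _ DP]; first exact: open_interior.
    by exists z => //; exact: nbhsx_ballx.
  by exists D.
pose D n k := projT1 (cid (cov n k)).
pose code (m : nat) : option (nat * nat * nat) := choice.unpickle m.
exists (fun m => if code m is Some (n, k, i)
  then nth x0 (D n k) i else x0) => x e e0.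
have [n xn] : exists n : nat, mdist x0 x <= n%:R.
  by exists (Num.truncn (mdist x0 x)).+1; rewrite ltW// truncnS_gt.
have [k ke] : exists k : nat, k.+1%:R^-1 < e.
  have [//|N] := @ltr_add_invr R 0%R e _; rewrite add0r => Ne.
  by exists N.
have [z zD zx] : exists2 z, z \in D n k & mdist z x < k.+1%:R^-1.
  rewrite /D; case: cid => D' /= /(_ x xn)[z zD' /interior_subset].
  by rewrite ballEmdist/= => zx; exists z.
exists (choice.pickle (n, k, index z (D n k))).
by rewrite /code choice.pickleK nth_index// (lt_trans zx).
Qed.

Lemma measurable_argmax (eps : R) (u : X -> R) : 0 <= eps -> continuous u ->
  exists T : X -> X, measurable_fun setT T /\ forall x, cball x eps (T x) /\
    forall y, cball x eps y -> u y <= u (T x).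
Proof.
move=> eps0 cu; have [s sdense] := dense_sequence.
pose f n (y : X) := if n is m.+1 then - mdist (s m) y else u y.
pose F := fix F n : X -> set X :=
  if n is m.+1 then argmax (f m) (F m) else fun x => cball x eps.
have cf n : continuous (f n).
  case: n => [|n]//= y; apply: continuousN; exact: mdist_continuous.
have FP n : compact_selectable (F n).
  elim: n => [|n IH]; first exact: cball_selectable.
  exact: argmax_selectable.
have FS n x : F n.+1 x `<=` F n x by move=> y [].
(* Compactness interchanges the intersection over [n] with meeting [C]: the sets [F n x] cut by [C]
   are nested, compact and nonempty. *)
have inter C : closed C -> \bigcap_n hits C (F n) `<=`
    [set x | (\bigcap_n F n x `&` C) !=set0].
  move=> cC x hx.
  have [|||y yK] := @nested_compact_inter _ _ X (fun n => F n x `&` C).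
  - by move=> n; exact: hx.
  - by move=> n; apply: compact_closedI => //; have [_ + _] := FP n; exact.
  - by move=> n; exact: setSI.
  by exists y; split => [n _|]; [have [] := yK n I|have [] := yK 0%N I].
have F0 x : exists y, forall n, F n x y.
  have [||y [Fy _]] := @inter setT _ x; first exact: closedT.
    by move=> n _; rewrite /hits/= setIT; have [+ _ _] := FP n; exact.
  by exists y => n; exact: Fy.
pose T x := projT1 (cid (F0 x)).
have TF x n : F n x (T x) by rewrite /T; case: cid.
(* Stage 0 maximizes [u], so the distance to [s n] is minimized in passing from [F n.+1] to
   [F n.+2]. Two survivors are thus equidistant from every [s n]; an [s n] within half their
   distance of one of them contradicts the triangle inequality. *)
have uniqF x y z : (forall n, F n x y) -> (forall n, F n x z) -> y = z.
  move=> Fy Fz; apply: contrapT => /eqP; rewrite -mdist_gt0 => yz.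
  have [n ny] := sdense y (mdist y z / 2) (divr_gt0 yz (ltr0n _ 2)).
  have [_ /(_ _ (Fz n.+1))/=] := Fy n.+2.
  have [_ /(_ _ (Fy n.+1))/=] := Fz n.+2.
  by have := metric_triangle y (s n) z; rewrite (metric_sym y (s n)); lra.
exists T; split.
  apply: measurable_fun_closed => C cC.
  rewrite (_ : T @^-1` C = \bigcap_n hits C (F n)).
    by apply: bigcapT_measurable => n; have [_ _] := FP n; exact.
  apply/seteqP; split => [x /= CT n _|x /(inter _ cC)[y [Fy Cy]]].
    by exists (T x); split.
  by rewrite /= (uniqF x (T x) y)// => n; exact: Fy.
by move=> x; split; [exact: (TF x 0%N)|have [] := TF x 1%N].
Qed.

(** Each point off the support has a null open neighborhood, hence lies in a null ball with center
    in the dense sequence and radius [1/(k+1)]. There are countably many such balls. *)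
Lemma measure_outside_supp (p : {measure set X -> \bar R}) (K : set X) :
  closed K -> supp p `<=` K -> p (~` K) = 0%E.
Proof.
move=> cK pK; have [s sdense] := dense_sequence.
have npos (k : nat) : 0 < k.+1%:R^-1 :> R by rewrite invr_gt0.
pose B n k : set X := ball (s n) (k.+1%:R^-1 : R).
have mB n k : measurable (B n k) by apply: borel_open; exact: metric_ball_open.
(* Balls of positive measure are replaced by the empty set, so that the union over all [n] and [k]
   is negligible. *)
pose N n k : set X := if p (B n k) == 0%E then B n k else set0.
have pN n k : p.-negligible (N n k).
  rewrite /N; case: eqP => [B0|_]; last exact: negligible_set0.
  exact/negligibleP.
apply: measure_negligible; first by apply: measurableC; exact: borel_closed.
apply: (negligibleS _ (negligible_bigcup
  (fun n => negligible_bigcup (fun k => pN n k)))).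
move=> x Kx; have /existsNP[U /not_implyP[oU /not_implyP[Ux /negP]]] : ~ supp p x.
  by move/pK.
rewrite lt0e measure_ge0 andbT negbK => /eqP pU.
have /nbhs_ballP[_/posnumP[e] eU] : nbhs x U by exact: open_nbhs_nbhs.
have [//|k] := @ltr_add_invr R 0%R (e%:num / 2) _; rewrite add0r => ke.
have [n nx] := sdense x (k.+1%:R^-1) (npos _).
exists n => //; exists k => //; rewrite /N.
have -> : p (B n k) == 0%E.
  rewrite eq_le measure_ge0 andbT -pU; apply: le_measure; rewrite ?inE//.
    exact: borel_open.
  move=> y; rewrite /B ballEmdist/= => ny; apply: eU; rewrite ballEmdist/=.
  rewrite (splitr e%:num) (le_lt_trans (metric_triangle x (s n) y))//.
  by rewrite metric_sym ltrD// (lt_trans _ ke).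
by rewrite /B ballEmdist.
Qed.

End proper.

(** * Integration *)

Section integral.
Local Open Scope ereal_scope.
Local Open Scope charge_scope.
Import HBNNSimple.
Context {d : measure_display} {T : measurableType d} {R : realType}.
Implicit Types (mu : {measure set T -> \bar R}) (p q : {finite_measure set T -> \bar R}).

(* [f] need not be measurable: the inner integral of the bracket energy is only
   almost everywhere equal to a measurable function of [x]. *)
Lemma ae_le_integral mu (f h : T -> \bar R) :
  measurable_fun setT h -> (forall x, 0 <= h x) ->
  {ae mu, forall x, f x <= h x} -> \int[mu]_x f x <= \int[mu]_x h x.
Proof.
move=> mh h0 fh; rewrite integralE.
apply: (@le_trans _ _ (\int[mu]_x f^\+ x)).
  rewrite -[leRHS]sube0; apply: leeB => //.
  by apply: integral_ge0 => x _; exact: funeneg_ge0.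
rewrite ge0_integralTE; last by move=> x; exact: funepos_ge0.
apply: ge_ereal_sup => _ [g gf <-]; rewrite -integralT_nnsfun.
apply: ae_ge0_le_integral => //.
- by move=> x _; rewrite lee_fin.
- by apply/measurable_EFinP; exact: measurable_funP.
- move: fh; apply: filterS => x fx _; apply: (le_trans (gf x)).
  by rewrite funeposE ge_max fx h0.
Qed.

Lemma integrable_bounded p (f : T -> R) : measurable_fun setT f ->
  [bounded f x | x in setT] -> p.-integrable setT (EFin \o f).
Proof.
move=> mf bf; apply: measurable_bounded_integrable => //.
exact: fin_num_fun_lty (fin_num_measure p).
Qed.

Lemma integrable_mscale mu (k : {nonneg R}) f : mu.-integrable setT f ->
  (mscale k mu).-integrable setT f.
Proof.
move=> /integrableP[mf foo]; apply/integrableP; split => //.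
rewrite ge0_integral_mscale//; last exact: measurableT_comp.
by rewrite lte_mul_pinfty.
Qed.

Lemma integral_mscale mu (k : {nonneg R}) f : mu.-integrable setT f ->
  \int[mscale k mu]_x f x = k%:num%:E * \int[mu]_x f x.
Proof.
move=> fi; have mf := measurable_int _ fi.
rewrite (integralE (mscale k mu)) (integralE mu) muleBr//; last first.
  rewrite fin_num_adde_defl// fin_numN.
  exact: (integrable_fin_num measurableT (integrable_funeneg _ _)).
have mfp := measurable_funepos mf; have mfn := measurable_funeneg mf.
by rewrite !ge0_integral_mscale.
Qed.

Lemma integrable_measure_add p q f : p.-integrable setT f ->
  q.-integrable setT f -> (measure_add p q).-integrable setT f.
Proof.
move=> /integrableP[mf pf] /integrableP[_ qf]; apply/integrableP; split => //.
rewrite ge0_integral_measure_add//; last exact: measurableT_comp.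
exact: lte_add_pinfty.
Qed.

Lemma integrable_realP mu f : mu.-integrable setT f ->
  exists r : R, \int[mu]_x f x = r%:E.
Proof.
move=> /(integrable_fin_num measurableT) ffin.
by exists (fine (\int[mu]_x f x)); rewrite fineK.
Qed.

(** With [P - N] the Jordan decomposition, [P - N = k (p - q)] rearranges to the equality
    [P + k q = k p + N] of positive measures. Integrating [f] and rearranging back is legitimate
    because a bounded [f] has finite integral against all four. *)
Lemma charge_integralE (nu : {charge set T -> \bar R}) (k : {nonneg R}) p q
    (f : T -> R) :
  (forall A, measurable A -> nu A = k%:num%:E * (p A - q A)) ->
  measurable_fun setT f -> [bounded f x | x in setT] ->
  charge_integral nu (EFin \o f) =
  k%:num%:E * (\int[p]_x (f x)%:E - \int[q]_x (f x)%:E).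
Proof.
move=> nupq mf bf; rewrite /charge_integral.
set nuPN := projT2 (cid (projT2 (cid (Hahn_decomposition nu)))).
set P := jordan_pos nuPN; set N := jordan_neg nuPN.
have fp := integrable_bounded p mf bf; have fq := integrable_bounded q mf bf.
have fP := integrable_bounded P mf bf; have fN := integrable_bounded N mf bf.
have : \int[measure_add P (mscale k q)]_x (f x)%:E =
    \int[measure_add (mscale k p) N]_x (f x)%:E.
  apply: eq_measure_integral => A mA _.
  change (measure_add P (mscale k q) A = measure_add (mscale k p) N A).
  rewrite !measure_addE /mscale/=.
  have := nupq A mA; rewrite (jordan_decomp nuPN mA) /cadd/= cscaleN1.
  change (P A - N A = k%:num%:E * (p A - q A) ->
    P A + k%:num%:E * q A = k%:num%:E * p A + N A).
  have [[a ->] [b ->] [a' ->] [b' ->]] :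
      [/\ exists a, P A = a%:E, exists a, N A = a%:E,
          exists a, p A = a%:E & exists a, q A = a%:E].
    by split; [exists (fine (P A))|exists (fine (N A))|exists (fine (p A))|
      exists (fine (q A))]; rewrite fineK// fin_num_measure.
  rewrite -!EFinB -!EFinM -!EFinD => -[e]; congr (_%:E); lra.
rewrite !integral_measure_add//; [|exact: integrable_mscale..].
rewrite !integral_mscale//.
have [a ->] := integrable_realP fp; have [b ->] := integrable_realP fq.
have [a' ->] := integrable_realP fP; have [b' ->] := integrable_realP fN.
rewrite -!EFinB -!EFinM -!EFinD => -[e]; congr (_%:E); lra.
Qed.

(** The derivative agrees almost everywhere with a version that is nonnegative everywhere. For that
    version the absolute value passes to [f], and the change of variables for nonnegative functions
    gives the integral of [|f|] against [p]. *)
Lemma rn_integrable p q (f : T -> \bar R) : p `<< q -> p.-integrable setT f ->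
  q.-integrable setT (fun x => f x * ('d (charge_of_finite_measure p) '/d q) x).
Proof.
move=> pq /integrableP[mf fi]; apply/integrableP; split.
  exact: emeasurable_funM.
rewrite (ae_eq_integral (fun x => `|f x| * Radon_Nikodym_SigmaFinite.f p q x))//.
- rewrite Radon_Nikodym_SigmaFinite.change_of_variables//.
  exact: measurableT_comp.
- by apply: measurableT_comp => //; exact: emeasurable_funM.
- apply: emeasurable_funM; first exact: measurableT_comp.
  exact: measurable_int (Radon_Nikodym_SigmaFinite.f_integrable pq).
- have := ae_eq_Radon_Nikodym_SigmaFinite pq measurableT.
  apply: filterS => x /(_ I) <- _; rewrite abseM.
  by rewrite (gee0_abs (Radon_Nikodym_SigmaFinite.f_ge0 pq x)).
Qed.

End integral.

(** * The image of a finite measure under a random walk *)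

Section kcst.
Local Open Scope ereal_scope.
Local Open Scope charge_scope.
Context {d : measure_display} {T : measurableType d} {R : realType}.
Variable rho : {finite_measure set T -> \bar R}.

(** Viewing [rho] as a constant kernel makes its image under [m] a composition of kernels, which
    brings sigma-additivity and the iterated integral formula with it. *)
Definition kcst (_ : T) : {measure set T -> \bar R} := rho.

Let measurable_kcst U : measurable U -> measurable_fun setT (kcst ^~ U).
Proof. by move=> _; exact: measurable_cst. Qed.

HB.instance Definition _ := isKernel.Build _ _ _ _ _ kcst measurable_kcst.

Let kcst_uub : measure_fam_uub kcst.
Proof.
exists (fine (rho setT) + 1)%R => x; rewrite EFinD fineK ?fin_num_measure//.
by rewrite lteDl ?fin_num_measure// lte01.
Qed.

HB.instance Definition _ := Kernel_isFinite.Build _ _ _ _ _ kcst kcst_uub.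

End kcst.

Section kernel_push.
Local Open Scope ereal_scope.
Local Open Scope charge_scope.
Context {d : measure_display} {T : measurableType d} {R : realType}.
Variables (rho : {finite_measure set T -> \bar R}) (m : R.-pker T ~> T).

Definition kernel_push : set T -> \bar R :=
  kcomp (kcst rho) (kernel.kernel_snd m) point.

Lemma kernel_pushE A : kernel_push A = \int[rho]_x m x A.
Proof. by []. Qed.

HB.instance Definition _ := Measure.on kernel_push.

Let kernel_push_fin : fin_num_fun kernel_push.
Proof.
move=> A mA; rewrite ge0_fin_numE ?measure_ge0//.
apply: (@le_lt_trans _ _ (\int[rho]_x cst 1 x)).
  rewrite kernel_pushE; apply: ge0_le_integral => //; first exact: measurable_kernel.
  by move=> x _; rewrite -(@prob_kernel _ _ _ _ _ m x) le_measure ?inE.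
by rewrite integral_cst// mul1e ltey_eq fin_num_measure.
Qed.

HB.instance Definition _ := Measure_isFinite.Build _ _ _ kernel_push kernel_push_fin.

Lemma ge0_integral_kernel_push (f : T -> \bar R) : (forall x, 0 <= f x) ->
  measurable_fun setT f -> \int[kernel_push]_x f x = \int[rho]_x \int[m x]_y f y.
Proof. by move=> f0 mf; rewrite /kernel_push integral_kcomp. Qed.

(** The formula holds for the positive and negative parts separately. As [kernel_push] is finite and
    [f] bounded, the means of both parts are [rho]-integrable, so the two formulas can be
    subtracted. *)
Lemma integral_kernel_push (f : T -> R) : measurable_fun setT f ->
  [bounded f x | x in setT] ->
  rho.-integrable setT (fun x => \int[m x]_y (f y)%:E) /\
  \int[kernel_push]_x (f x)%:E = \int[rho]_x \int[m x]_y (f y)%:E.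
Proof.
move=> mf bf; pose g := EFin \o f.
have mg : measurable_fun setT g by exact/measurable_EFinP.
have ig (p : {finite_measure set T -> \bar R}) : p.-integrable setT g.
  exact: integrable_bounded.
have gE x : \int[m x]_y g y = \int[m x]_y g^\+ y - \int[m x]_y g^\- y.
  by rewrite integralE.
have pos h : (forall x, 0 <= h x) -> measurable_fun setT h ->
    (forall p : {finite_measure set T -> \bar R}, p.-integrable setT h) ->
    rho.-integrable setT (fun x => \int[m x]_y h y).
  move=> h0 mh ih; apply/integrableP; split.
    by apply: measurable_fun_integral_kernel => //; exact: measurable_kernel.
  under eq_integral do rewrite gee0_abs ?integral_ge0//.
  rewrite -ge0_integral_kernel_push//.
  by have [r ->] := integrable_realP (ih kernel_push); exact: ltry.
have ip : rho.-integrable setT (fun x => \int[m x]_y g^\+ y).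
  apply: pos => [x||p]; [exact: funepos_ge0|exact: measurable_funepos|].
  exact: (integrable_funepos measurableT (ig p)).
have iN : rho.-integrable setT (fun x => \int[m x]_y g^\- y).
  apply: pos => [x||p]; [exact: funeneg_ge0|exact: measurable_funeneg|].
  exact: (integrable_funeneg measurableT (ig p)).
split.
  apply: (eq_integrable measurableT (fun x =>
    \int[m x]_y g^\+ y - \int[m x]_y g^\- y)); last exact: integrableB.
  by move=> x _; rewrite -gE.
transitivity (\int[kernel_push]_x g x) => //; rewrite integralE.
rewrite !ge0_integral_kernel_push//;
  [|exact: measurable_funeneg|exact: measurable_funepos].
by rewrite -integralB//; apply: eq_integral => x _; rewrite -gE.
Qed.

End kernel_push.

(** * The bracket as a density *)

Section bracket.
Local Open Scope ereal_scope.
Local Open Scope charge_scope.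
Context {R : realType} {d : measure_display} {X : borelMetricType d R}.
Variables (rho0 rho1 : {finite_measure set X -> \bar R}) (m0 m1 : R.-pker X ~> X).

Lemma fmeasure_add_eq0 (p q : {finite_measure set X -> \bar R}) A :
  fmeasure_add p q A = 0 -> p A = 0 /\ q A = 0.
Proof.
rewrite /fmeasure_add measure_addE => /eqP.
by rewrite padde_eq0 ?measure_ge0// => /andP[/eqP ? /eqP].
Qed.

Lemma fmeasure_add_dominates : rho0 `<< fmeasure_add rho0 rho1 /\
  rho1 `<< fmeasure_add rho0 rho1.
Proof.
by split; apply/null_content_dominatesP => A mA /fmeasure_add_eq0[].
Qed.

Lemma midpoint_dominates x : kmeas m0 x `<< midpoint m0 m1 x /\
  kmeas m1 x `<< midpoint m0 m1 x.
Proof.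
suff H A : midpoint m0 m1 x A = 0 -> m0 x A = 0 /\ m1 x A = 0.
  by split; apply/null_content_dominatesP => A mA /H[].
rewrite /midpoint /mscale/= => /eqP; rewrite mule_eq0 => /orP[|/eqP].
  by rewrite eqe invr_eq0 pnatr_eq0.
exact: fmeasure_add_eq0.
Qed.

Let a0 := 'd (charge_of_finite_measure rho0) '/d (fmeasure_add rho0 rho1).
Let a1 := 'd (charge_of_finite_measure rho1) '/d (fmeasure_add rho0 rho1).

(** For fixed [x] the weights [a0 x] and [a1 x] are finite constants, so the integral splits in two,
    and the change of variables for each derivative in [y] replaces the midpoint by [m0 x] or
    [m1 x]. *)
Lemma integral_bracket (g : X -> R) x :
  (m0 x).-integrable setT (EFin \o g) -> (m1 x).-integrable setT (EFin \o g) ->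
  \int[midpoint m0 m1 x]_y ((g y)%:E * bracket rho0 rho1 m0 m1 x y) =
  (\int[m0 x]_y (g y)%:E) * a0 x + (\int[m1 x]_y (- g y)%:E) * a1 x.
Proof.
move=> g0 g1; have [dom0 dom1] := midpoint_dominates x.
have := Radon_Nikodym_change_of_variables dom0 measurableT g0.
have := Radon_Nikodym_change_of_variables dom1 measurableT g1.
have := rn_integrable dom0 g0; have := rn_integrable dom1 g1.
rewrite /bracket -/a0 -/a1.
have b0fin y : ('d (charge_of_finite_measure (kmeas m0 x)) '/d
    (midpoint m0 m1 x)) y \is a fin_num.
  exact: Radon_Nikodym_fin_num.
have b1fin y : ('d (charge_of_finite_measure (kmeas m1 x)) '/d
    (midpoint m0 m1 x)) y \is a fin_num.
  exact: Radon_Nikodym_fin_num.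
move: b0fin b1fin.
set b0 := Radon_Nikodym _ _; set b1 := Radon_Nikodym _ _ => b0fin b1fin.
have [rdom0 rdom1] := fmeasure_add_dominates.
have : a0 x \is a fin_num by exact: Radon_Nikodym_fin_num.
have : a1 x \is a fin_num by exact: Radon_Nikodym_fin_num.
move: (a0 x) (a1 x) => [s0| |] [s1| |]// _ _ i1 i0 e1 e0.
transitivity (\int[midpoint m0 m1 x]_y
    (s0%:E * ((g y)%:E * b0 y) - s1%:E * ((g y)%:E * b1 y))).
  apply: eq_integral => y _; move: (b0fin y) (b1fin y).
  by case: (b0 y) => // r0 _; case: (b1 y) => // r1 _; congr (_%:E); lra.
rewrite integralB//; [|exact: integrableZl..].
rewrite !integralZl// e0 e1.
under [X in _ = _ + X * _]eq_integral do rewrite EFinN.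
rewrite integralN; last exact: integrable_add_def.
by rewrite (muleC s0%:E) (muleC s1%:E) mulNe.
Qed.

End bracket.

(** * The energies *)

Section energy.
Local Open Scope ereal_scope.
Local Open Scope charge_scope.
Context {R : realType} {d : measure_display} {X : borelMetricType d R}.
Variable eps : R.
Hypothesis eps_gt0 : (0 < eps)%R.
Implicit Types (rho : {finite_measure set X -> \bar R}) (u : X -> R)
  (m : R.-pker X ~> X).

(** The first integrand of the total variation. As the infimum of [u] is minus the supremum of
    [- u], the second integrand is [gap (- u)], and every estimate is made for one sign only. *)
Definition gap u (x : X) : R := ((sup (u @` cball x eps) - u x) / eps)%R.

Definition grad_mean m u x : \bar R := \int[m x]_y (grad_eps eps u x y)%:E.

Lemma sup_argmax u (K : set X) t : K t -> (forall y, K y -> u y <= u t)%R ->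
  sup (u @` K) = u t.
Proof.
move=> Kt ut; apply/eqP; rewrite eq_le; apply/andP; split.
  by apply: ge_sup; [exists (u t), t|move=> _ [y Ky <-]; exact: ut].
by apply: ub_le_sup; [exists (u t) => _ [y Ky <-]; exact: ut|exists t].
Qed.

Lemma inf_sup_opp u (K : set X) : inf (u @` K) = (- sup ((- u)%R @` K))%R.
Proof. by rewrite /inf image_comp. Qed.

Lemma TV_gap rho0 rho1 u : TV eps rho0 rho1 u =
  \int[rho0]_x (gap u x)%:E + \int[rho1]_x (gap (- u)%R x)%:E.
Proof.
congr (_ + _); apply: eq_integral => x _; congr (_%:E).
by rewrite /gap inf_sup_opp fctE !opprK addrC.
Qed.

Lemma grad_opp u x y : grad_eps eps (- u)%R x y = (- grad_eps eps u x y)%R.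
Proof. by rewrite /grad_eps !fctE -mulNr opprB opprK addrC. Qed.

Lemma grad_energyE rho0 rho1 u m0 m1 : grad_energy eps rho0 rho1 u m0 m1 =
  \int[rho0]_x grad_mean m0 u x + \int[rho1]_x grad_mean m1 (- u)%R x.
Proof.
congr (_ + _); apply: eq_integral => x _; apply: eq_integral => y _.
by rewrite grad_opp.
Qed.

Lemma measurable_grad u x : measurable_fun setT u ->
  measurable_fun setT (grad_eps eps u x).
Proof. by move=> mu; apply: measurable_funM => //; exact: measurable_funB. Qed.

Section divergence.
Variable u : X -> R.
Hypotheses (mu : measurable_fun setT u) (bu : [bounded u x | x in setT]).

Lemma integral_grad_mean rho m : \int[rho]_x grad_mean m u x =
  (eps^-1)%:E * (\int[kernel_push rho m]_x (u x)%:E - \int[rho]_x (u x)%:E).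
Proof.
have [ium ->] := integral_kernel_push rho m mu bu.
have iu (p : {finite_measure set X -> \bar R}) : p.-integrable setT (EFin \o u).
  exact: integrable_bounded.
transitivity (\int[rho]_x ((eps^-1)%:E * (\int[m x]_y (u y)%:E - (u x)%:E)));
    last first.
  rewrite (integralZl measurableT (integrableB measurableT ium (iu rho))).
  by rewrite (integralB measurableT ium (iu rho)).
apply: eq_integral => x _; rewrite /grad_mean /grad_eps.
under eq_integral do rewrite mulrC EFinM EFinB.
have im : (m x).-integrable setT (EFin \o u) by exact: (iu (kmeas m x)).
have ic : (m x).-integrable setT (cst (u x)%:E).
  exact: (finite_measure_integrable_cst (kmeas m x)).
rewrite integralZl//; last exact: integrableB.
by rewrite integralB// integral_cst// prob_kernel mule1.
Qed.

Lemma div_epsE rho m A : measurable A ->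
  div_eps eps rho m A = (eps^-1)%:E * (rho A - kernel_push rho m A).
Proof.
move=> mA; rewrite /div_eps kernel_pushE (eq_integral (cst 1)).
  by rewrite integral_cst// mul1e.
by move=> x _; exact: prob_kernel.
Qed.

End divergence.

Lemma bounded_opp u : [bounded u x | x in setT] -> [bounded (- u)%R x | x in setT].
Proof.
move=> [M [Mr Mu]]; exists M; split => // r Mlr x _.
by rewrite /= fctE normrN; exact: Mu.
Qed.

Lemma div_energyE rho0 rho1 u m0 m1 : measurable_fun setT u ->
    [bounded u x | x in setT] ->
  div_energy eps rho0 rho1 u m0 m1 = grad_energy eps rho0 rho1 u m0 m1.
Proof.
move=> mu bu; rewrite grad_energyE !integral_grad_mean//; last 2 first.
- exact: measurableT_comp.
- exact: bounded_opp.
have Vge0 : (0 <= eps^-1)%R by rewrite invr_ge0 ltW.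
(* Collecting the positive and the negative terms of the two divergences writes the charge as
   [eps^-1] times a difference of two finite measures. *)
rewrite /div_energy (@charge_integralE _ _ _ _ (NngNum Vge0)
  (fmeasure_add rho0 (kernel_push rho1 m1)) (fmeasure_add (kernel_push rho0 m0) rho1))//=.
- have iu (p : {finite_measure set X -> \bar R}) : p.-integrable setT (EFin \o u).
    exact: integrable_bounded.
  rewrite (integral_measure_add measurableT (iu rho0) (iu (kernel_push rho1 m1))).
  rewrite (integral_measure_add measurableT (iu (kernel_push rho0 m0)) (iu rho1)).
  have opp (p : {finite_measure set X -> \bar R}) :
      \int[p]_x ((- u)%R x)%:E = - \int[p]_x (u x)%:E.
    by rewrite -integralN ?integrable_add_def//; exact: iu.
  rewrite !opp.
  have [a ->] := integrable_realP (iu rho0).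
  have [b ->] := integrable_realP (iu rho1).
  have [a' ->] := integrable_realP (iu (kernel_push rho0 m0)).
  have [b' ->] := integrable_realP (iu (kernel_push rho1 m1)).
  rewrite -!(EFinN, EFinD, EFinM); congr (_%:E); lra.
- move=> A mA; rewrite /div_pair /cadd/= /copp/= !div_epsE//.
  rewrite /fmeasure_add !measure_addE.
  change ((eps^-1)%:E * (rho0 A - kernel_push rho0 m0 A) -
      (eps^-1)%:E * (rho1 A - kernel_push rho1 m1 A) =
    (eps^-1)%:E * (rho0 A + kernel_push rho1 m1 A - (kernel_push rho0 m0 A + rho1 A))).
  have finP (p : {finite_measure set X -> \bar R}) : exists r, p A = r%:E.
    by exists (fine (p A)); rewrite fineK// fin_num_measure.
  have [a ->] := finP rho0; have [b ->] := finP rho1.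
  have [a' ->] := finP (kernel_push rho0 m0); have [b' ->] := finP (kernel_push rho1 m1).
  rewrite -!(EFinN, EFinD, EFinM); congr (_%:E); lra.
Qed.

(** * Pointwise bound and its attainment *)

Section support.
Hypothesis X_proper : proper_space X.
Variable u : X -> R.
Hypothesis cu : continuous u.

Let mu : measurable_fun setT u := continuous_borel cu.

Let eps_ge0 : (0 <= eps)%R := ltW eps_gt0.

Lemma gap_ge0 x : (0 <= gap u x)%R.
Proof.
have [T [_ /(_ x)[xT Tmax]]] := measurable_argmax X_proper eps_ge0 cu.
rewrite /gap (sup_argmax xT Tmax) divr_ge0// subr_ge0 Tmax//.
exact: cball_center.
Qed.

(** The supremum over the ball is [u] composed with the Borel choice of maximizers. *)
Lemma measurable_gap : measurable_fun setT (gap u).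
Proof.
have [T [mT TP]] := measurable_argmax X_proper eps_ge0 cu.
rewrite (_ : gap u = fun x => ((u (T x) - u x) / eps)%R).
  by apply: measurable_funM => //; apply: measurable_funB => //; exact: measurableT_comp.
by apply/funext => x; have [xT Tmax] := TP x; rewrite /gap (sup_argmax xT Tmax).
Qed.

(** The measure [m x] does not charge the complement of the ball. On the ball the gradient is at
    most [gap u x], and compactness bounds its absolute value, which gives integrability even for
    unbounded [u]. *)
Lemma grad_mean_le m x : supp (m x) `<=` cball x eps ->
  (m x).-integrable setT (EFin \o grad_eps eps u x) /\
  grad_mean m u x <= (gap u x)%:E.
Proof.
move=> mx; have mg := measurable_grad x mu.
have cK : closed (cball x eps : set X) by exact: cball_closed.
have ae (P : X -> Prop) : (forall y, cball x eps y -> P y) -> {ae m x, forall y, P y}.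
  move=> KP; exists (~` cball x eps); split.
  - by apply: measurableC; exact: borel_closed.
  - exact: measure_outside_supp.
  - by move=> y /= nPy Ky; apply: nPy; exact: KP.
have le y : cball x eps y -> (grad_eps eps u x y <= gap u x)%R.
  have [T [_ /(_ x)[xT Tmax]]] := measurable_argmax X_proper eps_ge0 cu.
  move=> Ky; rewrite /grad_eps /gap (sup_argmax xT Tmax).
  by rewrite ler_wpM2r ?invr_ge0// lerB// Tmax.
split; last first.
  rewrite /grad_mean (@le_trans _ _ (\int[m x]_y (cst (gap u x)%:E y)))//.
    apply: ae_le_integral => //; first by move=> y; rewrite lee_fin gap_ge0.
    by apply: ae => y Ky; rewrite lee_fin; exact: le.
  by rewrite integral_cst// prob_kernel mule1.
apply/integrableP; split; first exact/measurable_EFinP.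
have cgN : continuous (fun y => `|grad_eps eps u x y|%R).
  move=> y; apply: (@continuous_comp _ _ _ (grad_eps eps u x) Num.norm);
    last exact: norm_continuous.
  by apply: cvgM; [apply: cvgB; [exact: cu|exact: cvg_cst]|exact: cvg_cst].
have [c _ cmax] : exists2 c, cball x eps c & forall y, cball x eps y ->
    (`|grad_eps eps u x y| <= `|grad_eps eps u x c|)%R.
  apply: (compact_max cgN); last exact: cball_compact.
  by exists x; exact: cball_center.
apply: (@le_lt_trans _ _ (\int[m x]_y (cst (`|grad_eps eps u x c|%:E) y))).
  apply: ae_le_integral => //; first by move=> y; rewrite lee_fin.
  by apply: ae => y Ky; rewrite lee_fin; exact: cmax.
by rewrite integral_cst// prob_kernel mule1 ltry.
Qed.

Lemma optimal_walk : exists m, random_walk m /\ forall x,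
  [/\ supp (m x) `<=` cball x eps,
      (m x).-integrable setT (EFin \o grad_eps eps u x)
    & grad_mean m u x = (gap u x)%:E].
Proof.
have [T [mT TP]] := measurable_argmax X_proper eps_ge0 cu.
exists (kdirac mT); split.
  (* Against a Dirac mass the distance integrates to a single real number, so any base point
     serves. *)
  exists point => x; rewrite integral_dirac//.
    by rewrite diracT mul1e ltry.
  by apply/measurable_EFinP/continuous_borel; exact: mdist_continuous.
move=> x; have [xT Tmax] := TP x; have mg := measurable_grad x mu.
have sK : supp (kdirac mT x) `<=` cball x eps.
  move=> y sy; apply: contrapT => Ky.
  have := sy (~` cball x eps) (closed_openC (@cball_closed _ _ X x eps)) Ky.
  by rewrite /kdirac/= diracE memNset ?ltxx//= => -[].
split => //; first by have [] := grad_mean_le sK.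
rewrite /grad_mean integral_dirac//; last exact/measurable_EFinP.
by rewrite diracT mul1e /gap (sup_argmax xT Tmax).
Qed.

End support.
End energy.

(** * The maxima of the gradient and bracket energies *)

Section maximum.
Local Open Scope ereal_scope.
Local Open Scope charge_scope.
Context {R : realType} {d : measure_display} {X : borelMetricType d R}.
Variable eps : R.
Hypothesis eps_gt0 : (0 < eps)%R.
Hypothesis X_proper : proper_space X.
Variables rho0 rho1 : {finite_measure set X -> \bar R}.
Variable u : X -> R.
Hypothesis cu : continuous u.

Let cNu : continuous (- u)%R.
Proof. by move=> x; exact/continuousN/cu. Qed.

Lemma ae_fmeasure_add (P : X -> Prop) : {ae fmeasure_add rho0 rho1, forall x, P x} ->
  {ae rho0, forall x, P x} /\ {ae rho1, forall x, P x}.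
Proof. by move=> [N [mN /fmeasure_add_eq0[N0 N1] PN]]; split; exists N. Qed.

Lemma admissible_optimal : exists m0 m1, [/\ admissible eps rho0 rho1 m0,
  admissible eps rho0 rho1 m1,
  forall x, (m0 x).-integrable setT (EFin \o grad_eps eps u x) /\
    grad_mean eps m0 u x = (gap eps u x)%:E
  & forall x, (m1 x).-integrable setT (EFin \o grad_eps eps (- u)%R x) /\
    grad_mean eps m1 (- u)%R x = (gap eps (- u)%R x)%:E].
Proof.
have [m0 [rw0 m0P]] := optimal_walk eps_gt0 X_proper cu.
have [m1 [rw1 m1P]] := optimal_walk eps_gt0 X_proper cNu.
exists m0, m1; split.
- by split => //; apply: aeW => x; have [] := m0P x.
- by split => //; apply: aeW => x; have [] := m1P x.
- by move=> x; have [] := m0P x.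
- by move=> x; have [] := m1P x.
Qed.

Lemma grad_energy_max : is_max
  [set grad_energy eps rho0 rho1 u m0 m1 | m0 in admissible eps rho0 rho1
    & m1 in admissible eps rho0 rho1] (TV eps rho0 rho1 u).
Proof.
split.
  have [m0 [m1 [am0 am1 g0 g1]]] := admissible_optimal.
  exists m0 => //; exists m1 => //; rewrite grad_energyE TV_gap.
  by congr (_ + _); apply: eq_integral => x _; [have [_ ->] := g0 x|have [_ ->] := g1 x].
move=> _ [m0 [_ /ae_fmeasure_add[s0 _]] [m1 [_ /ae_fmeasure_add[_ s1]] <-]].
rewrite grad_energyE TV_gap; apply: leeD; apply: ae_le_integral.
- exact/measurable_EFinP/measurable_gap.
- by move=> x; rewrite lee_fin gap_ge0.
- by move: s0; apply: filterS => x /(grad_mean_le eps_gt0 X_proper cu)[].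
- exact/measurable_EFinP/measurable_gap.
- by move=> x; rewrite lee_fin gap_ge0.
- by move: s1; apply: filterS => x /(grad_mean_le eps_gt0 X_proper cNu)[].
Qed.

Let rho := fmeasure_add rho0 rho1.

(* The library's Radon-Nikodym derivatives are nonnegative only almost everywhere;
   these versions are nonnegative everywhere. *)
Let a0 := Radon_Nikodym_SigmaFinite.f rho0 rho.
Let a1 := Radon_Nikodym_SigmaFinite.f rho1 rho.

Let dom0 : rho0 `<< rho. Proof. by have [] := fmeasure_add_dominates rho0 rho1. Qed.
Let dom1 : rho1 `<< rho. Proof. by have [] := fmeasure_add_dominates rho0 rho1. Qed.

(** The density of the total variation with respect to [rho]. It bounds the inner bracket integral
    of every admissible pair almost everywhere, with equality for the optimal pair. *)
Let h x := (gap eps u x)%:E * a0 x + (gap eps (- u)%R x)%:E * a1 x.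

Let ge0_0 x : 0 <= (gap eps u x)%:E * a0 x.
Proof.
by rewrite mule_ge0 ?lee_fin ?gap_ge0//; exact: Radon_Nikodym_SigmaFinite.f_ge0.
Qed.

Let ge0_1 x : 0 <= (gap eps (- u)%R x)%:E * a1 x.
Proof.
by rewrite mule_ge0 ?lee_fin ?gap_ge0//; exact: Radon_Nikodym_SigmaFinite.f_ge0.
Qed.

Let m_0 : measurable_fun setT (fun x => (gap eps u x)%:E * a0 x).
Proof.
apply: emeasurable_funM; first exact/measurable_EFinP/measurable_gap.
exact: measurable_int (Radon_Nikodym_SigmaFinite.f_integrable dom0).
Qed.

Let m_1 : measurable_fun setT (fun x => (gap eps (- u)%R x)%:E * a1 x).
Proof.
apply: emeasurable_funM; first exact/measurable_EFinP/measurable_gap.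
exact: measurable_int (Radon_Nikodym_SigmaFinite.f_integrable dom1).
Qed.

Let mh : measurable_fun setT h.
Proof. exact: emeasurable_funD. Qed.

Let h_ge0 x : 0 <= h x.
Proof. exact: adde_ge0. Qed.

Lemma TV_density : TV eps rho0 rho1 u = \int[rho]_x h x.
Proof.
rewrite ge0_integralD// TV_gap.
rewrite !Radon_Nikodym_SigmaFinite.change_of_variables//.
- by move=> x; rewrite lee_fin gap_ge0.
- exact/measurable_EFinP/measurable_gap.
- by move=> x; rewrite lee_fin gap_ge0.
- exact/measurable_EFinP/measurable_gap.
Qed.

Let inner (m0 m1 : R.-pker X ~> X) x := \int[midpoint m0 m1 x]_y
  ((grad_eps eps u x y)%:E * bracket rho0 rho1 m0 m1 x y).

Let innerE (m0 m1 : R.-pker X ~> X) x :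
  (m0 x).-integrable setT (EFin \o grad_eps eps u x) ->
  (m1 x).-integrable setT (EFin \o grad_eps eps (- u)%R x) ->
  inner m0 m1 x =
    grad_mean eps m0 u x * ('d (charge_of_finite_measure rho0) '/d rho) x +
    grad_mean eps m1 (- u)%R x * ('d (charge_of_finite_measure rho1) '/d rho) x.
Proof.
move=> i0 i1; rewrite /inner integral_bracket//; last first.
  apply: (eq_integrable measurableT (\- (EFin \o grad_eps eps (- u)%R x))).
    by move=> y _ /=; rewrite grad_opp opprK.
  exact: integrableN.
by congr (_ + _ * _); apply: eq_integral => y _; rewrite grad_opp.
Qed.

Let ae_density : {ae rho, forall x,
  ('d (charge_of_finite_measure rho0) '/d rho) x = a0 x /\
  ('d (charge_of_finite_measure rho1) '/d rho) x = a1 x}.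
Proof.
have := ae_eq_Radon_Nikodym_SigmaFinite dom0 measurableT.
have := ae_eq_Radon_Nikodym_SigmaFinite dom1 measurableT.
by apply: filterS2 => x /(_ I) <- // /(_ I) <-.
Qed.

Lemma bracket_energy_max : is_max
  [set bracket_energy eps rho0 rho1 u m0 m1 | m0 in admissible eps rho0 rho1
    & m1 in admissible eps rho0 rho1] (TV eps rho0 rho1 u).
Proof.
rewrite TV_density; split.
  have [m0 [m1 [am0 am1 g0 g1]]] := admissible_optimal.
  exists m0 => //; exists m1 => //.
  (* For the optimal pair the identity holds at every [x], so [inner] is measurable here and can be
     compared with [h] almost everywhere. *)
  have iE : inner m0 m1 = fun x =>
      (gap eps u x)%:E * ('d (charge_of_finite_measure rho0) '/d rho) x +
      (gap eps (- u)%R x)%:E * ('d (charge_of_finite_measure rho1) '/d rho) x.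
    apply/funext => x; have [i0 <-] := g0 x; have [i1 <-] := g1 x.
    exact: innerE.
  transitivity (\int[rho]_x inner m0 m1 x) => //; rewrite iE.
  apply: ae_eq_integral => //.
    apply: emeasurable_funD; apply: emeasurable_funM => //;
      exact/measurable_EFinP/measurable_gap.
  move: ae_density; apply: filterS => x [e0 e1] _.
  by rewrite e0 e1.
move=> _ [m0 [_ s0] [m1 [_ s1] <-]].
apply: (@ae_le_integral _ _ _ rho (inner m0 m1)) => //.
move: ae_density s0 s1; apply: filterS3 => x [e0 e1] s0 s1.
have [i0 g0] := grad_mean_le eps_gt0 X_proper cu s0.
have [i1 g1] := grad_mean_le eps_gt0 X_proper cNu s1.
rewrite innerE// e0 e1; apply: leeD; apply: lee_wpmul2r => //;
  exact: Radon_Nikodym_SigmaFinite.f_ge0.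
Qed.

End maximum.

Theorem theorem2 (R : realType) (d : measure_display) (X : borelMetricType d R)
    (eps : R) (eps_gt0 : 0 < eps)
    (X_proper : proper_space X) (X_shrinking : shrinking X eps)
    (mu : probability (X * bool)%type R) :
  let rho0 := marginal mu false in
  let rho1 := marginal mu true in
  let M := admissible eps rho0 rho1 in
  (forall u : X -> R, continuous u ->
     is_max [set grad_energy eps rho0 rho1 u m0 m1 | m0 in M & m1 in M]
            (TV eps rho0 rho1 u) /\
     is_max [set bracket_energy eps rho0 rho1 u m0 m1 | m0 in M & m1 in M]
            (TV eps rho0 rho1 u)) /\
  (forall u : X -> R, continuous u -> [bounded u x | x in setT] ->
     is_max [set div_energy eps rho0 rho1 u m0 m1 | m0 in M & m1 in M]
            (TV eps rho0 rho1 u)).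
Proof.
move=> rho0 rho1 M; split => [u cu|u cu bu].
  by split; [exact: grad_energy_max|exact: bracket_energy_max].
have [[m0 Mm0 [m1 Mm1 E]] ub] := grad_energy_max eps_gt0 X_proper rho0 rho1 cu.
(* For bounded [u] the two energies agree on every pair of walks, so the maximum and its maximizers
   carry over. *)
have divE m m' := div_energyE eps_gt0 rho0 rho1 m m' (continuous_borel cu) bu.
split; first by exists m0 => //; exists m1 => //; rewrite divE.
by move=> _ [m Mm [m' Mm' <-]]; rewrite divE; apply: ub; exists m => //; exists m'.
Qed.
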